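(* Let $(\Omega,\mathcal F,\mathbb P)$ be a complete probability space, and let $C$ be a closed and convex subset of $\mathbb L^0_+=\mathbb L^0_+(\Omega,\mathcal F,\mathbb P)$. Then $C$ is convexly compact if and only if $C$ is bounded in probability.
   Context: $\mathbb L^0$ denotes the real vector space of $\mathbb P$-a.s. equivalence classes of real-valued random variables on $(\Omega,\mathcal F,\mathbb P)$, equipped with the topology of convergence in probability, induced by the complete translation-invariant metric $d(f,g)=\mathbb E[1\wedge|f-g|]$. $\mathbb L^0_+=\{f\in\mathbb L^0: f\ge 0 \text{ a.s.}\}$. A set $A\subseteq\mathbb L^0$ is bounded in probability if $\lim_{M\to\infty}\sup_{f\in A}\mathbb P[|f|\ge M]=0$ (the supremum over the empty set being $0$). A convex subset $C$ of a topological vector space is convexly compact if for any non-empty index set $A$ and any family $\{F_\alpha\}_{\alpha\in A}$ of closed and convex subsets of $C$, the condition that $\bigcap_{\alpha\in D}F_\alpha\ne\emptyset$ for every non-empty finite $D\subseteq A$ implies $\bigcap_{\alpha\in A}F_\alpha\neq\emptyset$. *)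

(* Defs.v *)
From HB Require Import structures.
From mathcomp Require Import all_boot all_order all_algebra.
From mathcomp Require Import all_classical all_reals all_analysis measurable_realfun.

Set Implicit Arguments.
Unset Strict Implicit.
Unset Printing Implicit Defensive.

Import Order.TTheory GRing.Theory Num.Theory.
Import numFieldNormedType.Exports.

Local Open Scope classical_set_scope.
Local Open Scope ring_scope.
Local Open Scope quotient_scope.

Definition L0 d (T : measurableType d) (R : realType) (P : probability T R) : Type :=
  {mfun_ P, T >-> R}.

Section L0_module.
Context d (T : measurableType d) (R : realType) (P : probability T R).

HB.instance Definition _ := Choice.on (L0 P).
HB.instance Definition _ := EqQuotient.on (L0 P).

(* A class is applied to a point through a chosen representative; only notions
   insensitive to null sets are evaluated in this way. *)
Definition L0_repr (f : L0 P) : {mfun T >-> R} := repr f.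
Coercion L0_repr : L0 >-> MeasurableFun.type.

Definition L0_class (f : {mfun T >-> R}) : L0 P := \pi_(L0 P) f.

Lemma L0_classE (f : {mfun T >-> R}) : {ae P, forall w, L0_class f w = f w}.
Proof.
have /eqmodP/asboolP : repr (L0_class f) = f %[mod L0 P] by rewrite reprK.
by apply: filterS => w /(_ I).
Qed.

Lemma L0_eqP (f g : L0 P) : f = g <-> {ae P, forall w, f w = g w}.
Proof.
split=> [->|fg]; first exact: aeW.
rewrite -[f]reprK -[g]reprK; apply/eqmodP/asboolP.
by apply: filterS fg => w + _.
Qed.

Let zero : L0 P := L0_class 0.
Let add (f g : L0 P) : L0 P := L0_class (L0_repr f + L0_repr g).
Let opp (f : L0 P) : L0 P := L0_class (- L0_repr f).
Let scale (k : R) (f : L0 P) : L0 P := L0_class (k *: L0_repr f).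

Let addE f g : {ae P, forall w, add f g w = f w + g w}.
Proof. exact: L0_classE. Qed.

Let scaleE k f : {ae P, forall w, scale k f w = k * f w}.
Proof. exact: L0_classE. Qed.

Let addA : associative add.
Proof.
move=> f g h; apply/L0_eqP; near=> w.
rewrite (near (addE f (add g h)) w)// (near (addE g h) w)//.
by rewrite (near (addE (add f g) h) w)// (near (addE f g) w)// addrA.
Unshelve. all: by end_near. Qed.

Let addC : commutative add.
Proof.
move=> f g; apply/L0_eqP.
by apply: filterS2 (addE f g) (addE g f) => w -> ->; rewrite addrC.
Qed.

Let add0 : left_id zero add.
Proof.
move=> f; apply/L0_eqP.
by apply: filterS2 (addE zero f) (L0_classE 0) => w -> ->; rewrite add0r.
Qed.

Let addN : left_inverse zero opp add.
Proof.
move=> f; apply/L0_eqP.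
apply: filterS3 (addE (opp f) f) (L0_classE (- L0_repr f)) (L0_classE 0).
by move=> w -> -> ->; rewrite addNr.
Qed.

HB.instance Definition _ := GRing.isZmodule.Build (L0 P) addA addC add0 addN.

Let scaleA a b f : scale a (scale b f) = scale (a * b) f.
Proof.
apply/L0_eqP.
apply: filterS3 (scaleE a (scale b f)) (scaleE b f) (scaleE (a * b) f).
by move=> w -> -> ->; rewrite mulrA.
Qed.

Let scale1 : left_id 1 scale.
Proof.
move=> f; apply/L0_eqP.
by apply: filterS (scaleE 1 f) => w ->; rewrite mul1r.
Qed.

Let scaleDr : right_distributive scale +%R.
Proof.
move=> a f g; apply/L0_eqP; near=> w.
rewrite (near (scaleE a (f + g)) w)// (near (addE f g) w)//.
rewrite (near (addE (scale a f) (scale a g)) w)//.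
by rewrite (near (scaleE a f) w)// (near (scaleE a g) w)// mulrDr.
Unshelve. all: by end_near. Qed.

Let scaleDl f : {morph scale^~ f : a b / a + b}.
Proof.
move=> a b; apply/L0_eqP; near=> w.
rewrite (near (scaleE (a + b) f) w)//.
rewrite (near (addE (scale a f) (scale b f)) w)//.
by rewrite (near (scaleE a f) w)// (near (scaleE b f) w)// mulrDl.
Unshelve. all: by end_near. Qed.

HB.instance Definition _ :=
  GRing.Zmodule_isLmodule.Build R (L0 P) scaleA scale1 scaleDr scaleDl.

Lemma L0_addE (f g : L0 P) : {ae P, forall w, (f + g : L0 P) w = f w + g w}.
Proof. exact: L0_classE. Qed.

Lemma L0_oppE (f : L0 P) : {ae P, forall w, (- f : L0 P) w = - f w}.
Proof. exact: L0_classE. Qed.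

Lemma L0_zeroE : {ae P, forall w, (0 : L0 P) w = 0}.
Proof. exact: L0_classE. Qed.

Lemma L0_scaleE (k : R) (f : L0 P) : {ae P, forall w, (k *: f : L0 P) w = k * f w}.
Proof. exact: L0_classE. Qed.

End L0_module.

Section L0_metric.
Context d (T : measurableType d) (R : realType) (P : probability T R).

Definition L0_dist (f g : L0 P) : R :=
  fine 'E_P[fun w => Num.min 1 `|f w - g w|].

Let tr (h : T -> R) (w : T) : \bar R := (Num.min 1 `|h w|)%:E.

Let tr_ge0 h w : (0 <= tr h w)%E.
Proof. by rewrite lee_fin le_min ler01 normr_ge0. Qed.

Let tr_le1 h w : (tr h w <= 1)%E.
Proof. by rewrite lee_fin ge_min lexx. Qed.

Let mtr (h : T -> R) : measurable_fun setT h -> measurable_fun setT (tr h).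
Proof.
move=> mh; apply/measurable_EFinP; apply: measurable_minr => //.
exact: measurableT_comp.
Qed.

Let int_tr_fin (h : T -> R) : measurable_fun setT h ->
  (\int[P]_w tr h w)%E \is a fin_num.
Proof.
move=> mh; rewrite ge0_fin_numE; last exact: integral_ge0.
apply: (@le_lt_trans _ _ (\int[P]_w (cst 1%E w))%E).
  by apply: ge0_le_integral => //; exact: mtr.
rewrite integral_cst// mul1e.
by rewrite (le_lt_trans (probability_le1 _ _)) ?ltry.
Qed.

Let int_tr_leD (f g h : T -> R) : measurable_fun setT f ->
  measurable_fun setT g -> measurable_fun setT h ->
  {ae P, forall w, Num.min 1 `|f w| <= Num.min 1 `|g w| + Num.min 1 `|h w|} ->
  fine (\int[P]_w tr f w) <= fine (\int[P]_w tr g w) + fine (\int[P]_w tr h w).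
Proof.
move=> mf mg mh fgh.
rewrite -fineD ?int_tr_fin//; apply: fine_le.
- exact: int_tr_fin.
- by rewrite fin_numD !int_tr_fin.
rewrite -ge0_integralD//; [|exact: mtr..].
apply: ae_ge0_le_integral => //.
- exact: mtr.
- by move=> w _; rewrite adde_ge0.
- by apply: emeasurable_funD; exact: mtr.
- by apply: filterS fgh => w + _; rewrite -EFinD lee_fin.
Qed.

Let dif (f g : L0 P) (w : T) : R := f w - g w.

Let mB (f g : L0 P) : measurable_fun setT (dif f g).
Proof. exact: measurable_funB. Qed.

Let distE (f g : L0 P) : L0_dist f g = fine (\int[P]_w tr (dif f g) w).
Proof. by rewrite /L0_dist unlock. Qed.

Let minr1D (x y z : R) : `|z| <= `|x| + `|y| ->
  Num.min 1 `|z| <= Num.min 1 `|x| + Num.min 1 `|y|.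
Proof.
move=> zxy; rewrite ge_min.
have [x1|x1] := leP 1 `|x|; first by rewrite lerDl le_min ler01 normr_ge0.
have [y1|y1] := leP 1 `|y|; first by rewrite lerDr normr_ge0.
by rewrite zxy orbT.
Qed.

Let dist0 f : L0_dist f f = 0.
Proof.
rewrite distE (eq_integral (cst 0%E)) ?integral0// => w _.
by rewrite /tr /dif subrr normr0 min_r.
Qed.

Let dist_eq0 f g : L0_dist f g = 0 -> f = g.
Proof.
rewrite distE => /eqP; rewrite fine_eq0 ?int_tr_fin// => /eqP fg0.
have : (\int[P]_w `|tr (dif f g) w|)%E = 0%E.
  by rewrite -[RHS]fg0; apply: eq_integral => w _; rewrite gee0_abs.
move=> /(ae_eq_integral_abs P measurableT (mtr (mB f g))) h0.
apply/L0_eqP; apply: filterS h0 => w /(_ I); rewrite /tr /dif => -[].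
have [_ /eqP|_ /eqP] := leP 1 `|f w - g w|; first by rewrite oner_eq0.
by rewrite normr_eq0 subr_eq0 => /eqP.
Qed.

Let dist_sym f g : L0_dist f g = L0_dist g f.
Proof.
rewrite !distE; congr fine; apply: eq_integral => w _.
by rewrite /tr /dif distrC.
Qed.

Let dist_triangle g f h : L0_dist f h <= L0_dist f g + L0_dist g h.
Proof.
rewrite !distE; apply: int_tr_leD; [exact: mB..|].
apply: aeW => w; apply: minr1D.
by rewrite (le_trans _ (ler_normD _ _))// addrA subrK.
Qed.

HB.instance Definition _ :=
  isMetric.Build R (L0 P) dist0 dist_eq0 dist_sym dist_triangle.

Let nbhs_dist (f : L0 P) (e : R) : 0 < e -> \forall g \near f, L0_dist f g < e.
Proof. by move=> e0; apply/nbhs_ballP; exists e => //= g; rewrite ballEmdist. Qed.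

Let cvg_dist (U : Type) (F : set_system U) (FF : Filter F) (h : U -> L0 P) (f : L0 P) :
  (forall e, 0 < e -> \forall u \near F, L0_dist f (h u) < e) -> h @ F --> f.
Proof.
move=> hf A /nbhs_ballP[e /= e0 eA].
by apply: filterS (hf e e0) => u fu; apply: eA; rewrite ballEmdist.
Qed.

Let dist_add (f g f' g' : L0 P) :
  L0_dist (f + g) (f' + g') <= L0_dist f f' + L0_dist g g'.
Proof.
rewrite !distE; apply: int_tr_leD; [exact: mB..|].
apply: filterS2 (L0_addE f g) (L0_addE f' g') => w e1 e2.
apply: minr1D; by rewrite /dif e1 e2 opprD addrACA ler_normD.
Qed.

Let add_continuous : continuous (fun x : L0 P * L0 P => x.1 + x.2).
Proof.
move=> [f g]; apply: cvg_dist => e e0 /=.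
have e2 : 0 < e / 2 by rewrite divr_gt0.
exists ([set f' | L0_dist f f' < e / 2], [set g' | L0_dist g g' < e / 2]).
  by split => /=; exact: nbhs_dist.
move=> [f' g'] [/= ff' gg'].
by rewrite (le_lt_trans (dist_add _ _ _ _))// [e]splitr ltrD.
Qed.

HB.instance Definition _ :=
  PreTopologicalNmodule_isTopologicalNmodule.Build (L0 P) add_continuous.

Let dist_scale (c k : R) (f g : L0 P) : 1 <= c -> `|k| <= c ->
  L0_dist (k *: f) (k *: g) <= c * L0_dist f g.
Proof.
move=> c1 kc; have c0 : 0 <= c by rewrite (le_trans ler01).
rewrite !distE -[c]/(fine c%:E) -fineM ?int_tr_fin//.
have mt := mtr (mB f g).
have ZE : (\int[P]_w (c%:E * tr (dif f g) w) =
    c%:E * \int[P]_w tr (dif f g) w)%E by exact: ge0_integralZl.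
rewrite -ZE fine_le ?int_tr_fin//; first by rewrite ZE fin_numM ?int_tr_fin.
apply: ae_ge0_le_integral => //.
- exact: mtr.
- by move=> w _; rewrite mule_ge0.
- exact: measurable_funeM.
apply: filterS2 (L0_scaleE k f) (L0_scaleE k g) => w kf kg _.
rewrite /tr /dif kf kg -mulrBr normrM -EFinM lee_fin ge_min.
have [_|_] := leP 1 `|f w - g w|; first by rewrite mulr1 c1.
by rewrite ler_wpM2r ?orbT.
Qed.

Let dist_scale0 (f : L0 P) (e : R) : 0 < e ->
  \forall t \near (0 : R), forall k, L0_dist (k *: f) ((k + t) *: f) < e.
Proof.
move=> e0.
pose h n (w : T) := n.+1%:R^-1 * f w.
have mh n : measurable_fun setT (h n) by exact: measurable_funM.
have [_ _] : [/\ P.-integrable setT (cst 0%E),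
    (fun n => \int[P]_w `|tr (h n) w - 0|)%E @ \oo --> 0%E &
    (fun n => \int[P]_w tr (h n) w)%E @ \oo --> (\int[P]_w cst 0 w)%E].
  apply: (@dominated_convergence _ _ _ P setT _ (fun n => tr (h n)) (cst 0%E) (cst 1%E)) => //.
  - by move=> n; exact: mtr.
  - apply: aeW => w _; apply/fine_cvgP; split; first exact: nearW.
    apply: (@squeeze_cvgr _ _ _ _ (cst 0) (fun n => n.+1%:R^-1 * `|f w|)).
    + apply: nearW => n; rewrite /= le_min ler01 normr_ge0/= ge_min.
      by rewrite /h normrM ger0_norm// lexx orbT.
    + exact: cvg_cst.
    + rewrite -[X in _ --> X](mul0r `|f w|); apply: cvgMl; exact: cvg_harmonic.
  - exact: finite_measure_integrable_cst.
  - by apply: aeW => w n _; rewrite gee0_abs.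
rewrite integral0 => /fine_cvgP[_ /cvgrPdist_lt/(_ e e0)[n _ /(_ n (leqnn n))]].
rewrite /= sub0r normrN => hn.
apply/nbhs_ballP; exists n.+1%:R^-1 => /=; first by rewrite invr_gt0.
move=> t; rewrite /ball/= sub0r normrN => tn k.
apply: le_lt_trans hn; rewrite ger0_norm; last by rewrite fine_ge0 ?integral_ge0.
rewrite distE fine_le ?int_tr_fin//.
apply: ae_ge0_le_integral => //; [exact: mtr..|].
apply: filterS2 (L0_scaleE k f) (L0_scaleE (k + t) f) => w e1 e2 _.
rewrite /tr /dif e1 e2 lee_fin -mulrBl opprD addNKr mulNr normrN !normrM.
rewrite le_min ge_min lexx/= ge_min; apply/orP; right.
by rewrite ler_wpM2r// [leRHS]ger0_norm// ltW.
Qed.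

Let scale_continuous : continuous (fun z : R^o * L0 P => z.1 *: z.2).
Proof.
move=> [k f]; apply: cvg_dist => e e0 /=.
have e2 : 0 < e / 2 by rewrite divr_gt0.
pose c := `|k| + 1.
have c1 : 1 <= c by rewrite lerDr.
have c0 : 0 < c by rewrite (lt_le_trans ltr01).
have [/= r r0 rt] := (nbhs_ballP _ _).1 (dist_scale0 f e2).
exists ([set k' | `|k - k'| < Num.min 1 r], [set g | L0_dist f g < e / 2 / c]).
  split => /=; last by apply: nbhs_dist; rewrite divr_gt0.
  by apply/nbhs_ballP; exists (Num.min 1 r) => //=; rewrite lt_min ltr01 r0.
move=> [k' g] [/= + fg]; rewrite lt_min => /andP[kk1 kkr].
rewrite (le_lt_trans (dist_triangle (k' *: f) _ _))// [e]splitr ltrD//.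
  have := rt (k' - k) _ k; rewrite [k + _]addrC subrK; apply.
  by rewrite /ball/= sub0r normrN distrC.
rewrite (le_lt_trans (@dist_scale c _ _ _ _ _))//.
  rewrite -[X in `|X|](subrKC k) (le_trans (ler_normD _ _))// lerD2l.
  by rewrite distrC ltW.
by rewrite mulrC -ltr_pdivlMr.
Qed.

HB.instance Definition _ :=
  TopologicalNmodule_isTopologicalLmodule.Build R (L0 P) scale_continuous.

End L0_metric.

Definition L0_nonneg d (T : measurableType d) (R : realType)
    (P : probability T R) : set (L0 P) :=
  [set f | {ae P, forall w, 0 <= f w}].
Arguments L0_nonneg {d T R} P.

(* 0 is adjoined because [ereal_sup set0] is -oo; this gives the empty family the
   supremum 0 and changes nothing for a nonempty one. *)
Definition bounded_in_probability d (T : measurableType d) (R : realType)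
    (P : probability T R) (A : set (L0 P)) : Prop :=
  ereal_sup (0%E |` [set P [set w | M <= `|f w|] | f in A]) @[M --> +oo%R]
    --> 0%E.

(* The F i are closed in E; when C itself is closed this is the same as being
   closed in the subspace C. *)
Definition convexly_compact (R : realType) (E : topologicalLmodType R)
    (C : set E) : Prop :=
  convex_set C /\
  forall (I : Type) (F : I -> set E), [set: I] !=set0 ->
    (forall i, [/\ F i `<=` C, closed (F i) & convex_set (F i)]) ->
    (forall D : set I, finite_set D -> D !=set0 ->
       \bigcap_(i in D) F i !=set0) ->
    \bigcap_i F i !=set0.

(* Main.v *)
(* Bounded implies convexly compact: f |-> E[exp(-f)] is bounded and strictly
   convex on the nonnegative cone, and its midpoint convexity gap at (f, g) is half
   of E[(exp(-f/2) - exp(-g/2))^2]. Hence near-minimizers over an increasing chain of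
   finite intersections, whose infima approach the supremum over all finite
   intersections, have exp(-f_n/2) converging fast in L2, so almost surely;
   boundedness in probability keeps the limit of exp(-f_n/2) positive.
   Conversely, if C is unbounded, the sets {f in C | E[min(1, f/n)] >= e} are a
   decreasing sequence of nonempty closed convex sets with empty intersection. *)
Require Import Defs.
From HB Require Import structures.
From mathcomp Require Import all_boot all_order all_algebra.
From mathcomp Require Import all_classical all_reals all_analysis.
From mathcomp Require Import measurable_realfun lra ring.

Set Implicit Arguments.
Unset Strict Implicit.
Unset Printing Implicit Defensive.

Import Order.TTheory GRing.Theory Num.Theory.
Import numFieldNormedType.Exports.

Local Open Scope classical_set_scope.
Local Open Scope ring_scope.

(** * Convex compactness forces boundedness in probability *)

Section convexly_compact_bounded.
Context d (T : measurableType d) (R : realType) (P : probability T R).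
Implicit Types (f g h : L0 P) (C : set (L0 P)).

(** Tail probabilities decrease in [M], so one threshold per [e] controls the whole limit at
    infinity. Both directions of the theorem use this form. *)
Lemma bounded_in_probabilityP C : bounded_in_probability C <->
  forall e : R, 0 < e -> exists M : R, forall f, C f ->
    (P [set w | (M <= `|f w|)%R] <= e%:E)%E.
Proof.
set S := fun M : R => ereal_sup (0%E |` [set P [set w | M <= `|f w|] | f in C]).
have S0 M : (0 <= S M)%E by apply: ereal_sup_ubound; left.
have mS (f : L0 P) M : measurable [set w | M <= `|f w|].
  rewrite -[X in measurable X]setTI; apply: measurable_fun_le => //.
  exact: measurableT_comp.
have S1 M : (S M <= 1)%E.
  by apply: ge_ereal_sup => _ [->|[f _ <-]]//; exact: probability_le1.
have Sfin M : S M \is a fin_num.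
  by rewrite ge0_fin_numE// (le_lt_trans (S1 M)) ?ltry.
split=> [/fine_cvgP[_ /cvgrPdist_lt bC] e e0|bC].
  (* Neighbourhoods of [+oo] contain only the points strictly above [M], hence [M + 1]. *)
  have [M [_ /(_ (M + 1))]] := bC e e0.
  rewrite ltrDl ltr01 sub0r normrN ger0_norm ?fine_ge0 ?S0// => /(_ isT) SM.
  exists (M + 1) => f Cf; apply: (@le_trans _ _ (S (M + 1))).
    by apply: ereal_sup_ubound; right; exists f.
  by rewrite -[S _]fineK// lee_fin ltW.
apply/fine_cvgP; split; first exact: nearW.
apply/cvgrPdist_le => e e0; have [M Me] := bC e e0.
exists M; split; first exact: num_real.
move=> x Mx; rewrite sub0r normrN ger0_norm ?fine_ge0 ?S0//.
rewrite -lee_fin fineK; last exact: Sfin.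
apply: ge_ereal_sup => _ [->|[f Cf <-]]; first by rewrite lee_fin ltW.
apply: le_trans (Me f Cf); apply: le_measure; rewrite ?inE//.
by move=> w /=; exact: le_trans (ltW Mx).
Qed.

Lemma measurable_min1_normB f g :
  measurable_fun setT (fun w => (Num.min 1 `|f w - g w|)%:E : \bar R).
Proof.
apply/measurable_EFinP; apply: measurable_minr => //.
by apply: measurableT_comp => //; exact: measurable_funB.
Qed.

Lemma L0_distE f g : (L0_dist f g)%:E = (\int[P]_w (Num.min 1 `|f w - g w|)%:E)%E.
Proof.
rewrite /L0_dist unlock fineK// ge0_fin_numE; last first.
  by apply: integral_ge0 => w _; rewrite lee_fin le_min ler01 normr_ge0.
apply: (@le_lt_trans _ _ (\int[P]_w (cst 1%E w))%E).
  apply: ge0_le_integral => //.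
  - exact: measurable_min1_normB.
  - by move=> w _; rewrite lee_fin ge_min lexx.
rewrite integral_cst// mul1e.
by rewrite (le_lt_trans (probability_le1 _ _)) ?ltry.
Qed.

(** Dominated convergence for the truncated differences, which are all below the constant 1,
    integrable for a probability. *)
Lemma ae_cvg_L0 (f_ : nat -> L0 P) f :
  {ae P, forall w, f_ n w @[n --> \oo] --> f w} -> f_ n @[n --> \oo] --> f.
Proof.
move=> ff.
have [_ _] : [/\ P.-integrable setT (cst 0%E),
    (fun n => \int[P]_w `|(Num.min 1 `|f w - f_ n w|)%:E - 0|)%E @ \oo --> 0%E &
    (fun n => \int[P]_w (Num.min 1 `|f w - f_ n w|)%:E)%E @ \oo
      --> (\int[P]_w cst 0 w)%E].
  apply: (@dominated_convergence _ _ _ P setT _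
    (fun n w => (Num.min 1 `|f w - f_ n w|)%:E) (cst 0%E) (cst 1%E)) => //.
  - by move=> n; exact: measurable_min1_normB.
  - apply: filterS ff => w fw _; apply/fine_cvgP; split; first exact: nearW.
    apply: (@squeeze_cvgr _ _ _ _ (cst 0) (fun n => `|f w - f_ n w|)).
    + by apply: nearW => n; rewrite /= le_min ler01 normr_ge0/= ge_min lexx orbT.
    + exact: cvg_cst.
    + rewrite -[X in _ --> X](normr0 R) -(subrr (f w)).
      by apply: cvg_norm; apply: cvgB => //; exact: cvg_cst.
  - exact: finite_measure_integrable_cst.
  - by apply: aeW => w n _; rewrite lee_fin ger0_norm ?ge_min ?lexx.
rewrite integral0 => /fine_cvgP[_ /cvgrPdist_lt f0].
apply/cvg_ballP => e e0; apply: filterS (f0 e e0) => n.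
rewrite ballEmdist /= sub0r normrN.
rewrite -L0_distE/= => /(le_lt_trans _); apply; exact: ler_norm.
Qed.

Lemma measurable_min1_normM (c : R) f :
  measurable_fun setT (fun w => (Num.min 1 `|c * f w|)%:E : \bar R).
Proof.
apply/measurable_EFinP; apply: measurable_minr => //.
by apply: measurableT_comp => //; exact: measurable_funM.
Qed.

Lemma L0_dist0ZE (c : R) f :
  (L0_dist 0 (c *: f))%:E = (\int[P]_w (Num.min 1 `|c * f w|)%:E)%E.
Proof.
rewrite L0_distE; apply: ae_eq_integral => //.
- exact: measurable_min1_normB.
- exact: measurable_min1_normM.
apply: filterS2 (L0_zeroE P) (L0_scaleE c f) => w -> -> _.
by rewrite sub0r normrN.
Qed.

Lemma le_L0_dist0Z (a b : R) f : 0 <= a -> a <= b ->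
  L0_dist 0 (a *: f) <= L0_dist 0 (b *: f).
Proof.
move=> a0 ab; rewrite -lee_fin !L0_dist0ZE; apply: ge0_le_integral => //.
- exact: measurable_min1_normM.
- exact: measurable_min1_normM.
move=> w _; rewrite lee_fin le_min !ge_min lexx/= !normrM; apply/orP; right.
by rewrite ler_wpM2r// !ger0_norm// (le_trans a0).
Qed.

(** Markov's inequality in truncated form: the indicator of the event lies below
    [min(1, |f| / M)]. *)
Lemma probability_ge_le_L0_dist (M : R) f : 0 < M ->
  (P [set w | (M <= `|f w|)%R] <= (L0_dist 0 (M^-1 *: f))%:E)%E.
Proof.
move=> M0; have mA : measurable [set w | M <= `|f w|].
  rewrite -[X in measurable X]setTI; apply: measurable_fun_le => //.
  exact: measurableT_comp.
rewrite L0_dist0ZE -[X in P X]setIT -integral_indic//.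
apply: ge0_le_integral => //.
- exact/measurable_EFinP.
- exact: measurable_min1_normM.
move=> w _; rewrite lee_fin indicE; case: (boolP (w \in _)) => [|_].
  rewrite inE/= => Mf; rewrite le_min lexx/= normrM normfV (gtr0_norm M0).
  by rewrite ler_pdivlMl// mulr1.
by rewrite le_min ler01 normr_ge0.
Qed.

(** On the half-line [x |-> min(1, c x)] is concave, and nonnegativity removes the absolute values.
    This makes superlevel sets of the distance to 0 convex within the cone. *)
Lemma L0_dist0Z_concave (c t : R) f g : 0 <= c -> 0 <= t -> t <= 1 ->
  L0_nonneg P f -> L0_nonneg P g ->
  t * L0_dist 0 (c *: f) + (1 - t) * L0_dist 0 (c *: g)
    <= L0_dist 0 (c *: (t *: f + (1 - t) *: g)).
Proof.
move=> c0 t0 t1 f0 g0; have u0 : 0 <= 1 - t by rewrite subr_ge0.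
have ZE (s : R) h : 0 <= s -> ((s * L0_dist 0 (c *: h))%:E =
    \int[P]_w (s%:E * (Num.min 1 `|c * h w|)%:E))%E.
  move=> s0; rewrite EFinM L0_dist0ZE ge0_integralZl//.
  exact: measurable_min1_normM.
have mm (s : R) h :
    measurable_fun setT (fun w => s%:E * (Num.min 1 `|c * h w|)%:E)%E.
  by apply: measurable_funeM; exact: measurable_min1_normM.
have pm (s : R) h w : 0 <= s -> (0 <= s%:E * (Num.min 1 `|c * h w|)%:E)%E.
  by move=> s0; rewrite mule_ge0.
rewrite -lee_fin EFinD !ZE// L0_dist0ZE.
rewrite -ge0_integralD//; [|by move=> w _; exact: pm..].
apply: ae_ge0_le_integral => //.
- by move=> w _; rewrite adde_ge0 ?pm.
- exact: emeasurable_funD.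
- exact: measurable_min1_normM.
near=> w => _.
have fw : 0 <= f w by near: w.
have gw : 0 <= g w by near: w.
rewrite (near (L0_addE (t *: f) ((1 - t) *: g)) w)//.
rewrite (near (L0_scaleE t f) w)// (near (L0_scaleE (1 - t) g) w)//.
rewrite -!EFinM -EFinD lee_fin !ger0_norm ?mulr_ge0 ?addr_ge0 ?mulr_ge0//.
have ml (x : R) : Num.min 1 x <= x by rewrite ge_min lexx orbT.
have m1 (x : R) : Num.min 1 x <= 1 by rewrite ge_min lexx.
rewrite le_min; apply/andP; split.
  rewrite (le_trans (lerD (ler_wpM2l t0 (m1 _)) (ler_wpM2l u0 (m1 _))))//.
  by rewrite !mulr1 subrKC.
rewrite (le_trans (lerD (ler_wpM2l t0 (ml _)) (ler_wpM2l u0 (ml _))))//.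
by rewrite mulrDr !(mulrCA c).
Unshelve. all: by end_near. Qed.

Lemma convexly_compact_bounded C : C `<=` L0_nonneg P -> closed C ->
  convexly_compact C -> bounded_in_probability C.
Proof.
move=> C0 clC [cvC ccC]; apply/bounded_in_probabilityP => e e0.
apply/not_existsP => nM.
(* Every threshold fails for [e]; the failure at [M = n + 1], with the Markov bound, yields a point
   of [F n]. *)
pose F (n : nat) := C `&` [set f | e <= L0_dist 0 (n.+1%:R^-1 *: f)].
have F_anti n m : (n <= m)%N -> F m `<=` F n.
  move=> nm f [Cf /= ef]; split=> //=; apply: le_trans ef _.
  by apply: le_L0_dist0Z; rewrite ?invr_ge0// lef_pV2 ?posrE// ler_nat.
have F_neq0 n : F n !=set0.
  have /existsNP[f /not_implyP[Cf /negP]] := nM n.+1%:R.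
  rewrite -ltNge => ef; exists f; split=> //=; rewrite -lee_fin.
  by apply: le_trans (probability_ge_le_L0_dist _ _); rewrite ?ltW.
have [n|D fD D0|f Ff] := ccC nat F (ex_intro _ 0%N I).
- split; first by move=> f [].
  + apply: closedI => //.
    rewrite (_ : [set _ | _] = ~` ((fun f => n.+1%:R^-1 *: f) @^-1` ball (0 : L0 P) e)).
      apply: open_closedC; apply: open_comp; last first.
        rewrite openE => f; rewrite ballEmdist/= => fe.
        apply/(nbhs_ballP f); exists (e - L0_dist 0 f) => /=; first by rewrite subr_gt0.
        move=> g; rewrite !ballEmdist/= ltrBrDl; apply: le_lt_trans.
        exact: (@metric_triangle _ (L0 P)).
      move=> f _.
      apply: (cvg_comp2 (cvg_cst _) cvg_id (@scale_continuous R (L0 P) (_, _))).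
    apply/seteqP; split=> f /=; rewrite ballEmdist/=; first by rewrite leNgt => /negP.
    by move/negP; rewrite -leNgt.
  + move=> f g t; rewrite !inE => -[Cf /= ef] [Cg /= eg]; split.
      by have := cvC f g t; rewrite !inE; exact.
    apply: le_trans (L0_dist0Z_concave _ _ _ (C0 _ Cf) (C0 _ Cg)) => //.
    rewrite -[e](subrKC (t%:num * e)) -{2}[e]mul1r -mulrBl.
    by rewrite lerD// ler_wpM2l// subr_ge0.
- have /finite_seqP[X ->] := fD.
  have [f Ff] := F_neq0 (\max_(i <- X) i)%N.
  by exists f => n /= nX; apply: F_anti Ff; exact: leq_bigmax_seq.
(* A common point [f] has all its multiples [f / (n + 1)] at distance at least [e] from 0, against
   continuity of scaling. *)
have f0 : n.+1%:R^-1 *: f @[n --> \oo] --> (0 : L0 P).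
  rewrite -[X in _ --> X](scale0r f).
  exact: (cvg_comp2 cvg_harmonic (cvg_cst _) (@scale_continuous R (L0 P) (_, _))).
have /cvg_ballP/(_ e e0)[n _ /(_ n (leqnn n))] := f0.
by rewrite /= ballEmdist/= ltNge; have [_ /= ->] := Ff n I.
Qed.

End convexly_compact_bounded.

(** * Pointwise bounds and convergence from geometric decay *)

Lemma ae_bounded_seq d (T : measurableType d) (R : realType)
    (mu : {measure set T -> \bar R}) (X : nat -> T -> R) (c : R) :
  (forall n, measurable_fun setT (X n)) -> (forall n w, 0 <= X n w) ->
  0 <= c -> (forall n, (\int[mu]_w (X n w)%:E <= (c / (2 ^ n.+1)%:R)%:E)%E) ->
  {ae mu, forall w, exists K, forall n, X n w <= K}.
Proof.
move=> mX X0 c0 Xc.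
(* The integrals of the terms add up to at most [c], so the sum is integrable, hence a.e. finite,
   and it dominates each of its nonnegative terms. *)
pose S w := (\sum_(0 <= n <oo) (X n w)%:E)%E.
have mS : measurable_fun setT S.
  apply: (@ge0_emeasurable_sum _ _ _ _ (fun n w => (X n w)%:E) xpredT) => [n w _ _|n _].
    by rewrite lee_fin.
  exact/measurable_EFinP.
have S0 w : (0 <= S w)%E by apply: nneseries_ge0 => n _ _; rewrite lee_fin.
have iS : mu.-integrable setT S.
  apply/integrableP; split=> //.
  under eq_integral do rewrite gee0_abs//.
  rewrite integral_nneseries//; last 2 first.
  - by move=> n; exact/measurable_EFinP.
  - by move=> n w _; rewrite lee_fin.
  apply: (@le_lt_trans _ _ c%:E); last exact: ltry.
  apply: le_trans (epsilon_trick0 xpredT c0).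
  by apply: lee_nneseries => // n _ _; apply: integral_ge0 => w _; rewrite lee_fin.
apply: filterS (integrable_ae measurableT iS) => w /(_ I) Sw.
exists (fine (S w)) => n; rewrite -lee_fin fineK//.
apply: le_trans (nneseries_lim_ge n.+1 _) => [|k _ _]; last by rewrite lee_fin.
by rewrite big_nat_recr//=; apply: leeDr; apply: sume_ge0 => k _; rewrite lee_fin.
Qed.

(** The telescoping series converges absolutely by comparison with a geometric one, and its partial
    sums differ from [u] by the constant [u 0]. *)
Lemma cvgn_of_geometric_steps (R : realType) (u : nat -> R) (K : R) :
  (forall n, `|u n.+1 - u n| <= K / 2 ^+ n) -> cvgn u.
Proof.
move=> uK.
have K0 : 0 <= K by have := le_trans (normr_ge0 _) (uK 0%N); rewrite expr0 divr1.
have tu : cvgn (series (telescope u)).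
  apply: normed_cvg; apply: (@series_le_cvg _ _ (geometric K 2^-1)) => //.
  - by move=> n; exact: normr_ge0.
  - by move=> n; rewrite /= mulr_ge0// exprn_ge0// invr_ge0.
  - by move=> n /=; rewrite exprVn; exact: uK.
  - by apply: is_cvg_geometric_series; rewrite ger0_norm ?invf_lt1 ?ltr1n.
rewrite (_ : u = series (telescope u) \+ cst (u 0%N)).
  by apply: is_cvgD => //; exact: is_cvg_cst.
by apply/funext => n; rewrite telescopeK /= subrK.
Qed.

(** * The functional [E[exp(-|f|)]] and its convexity gap *)

Section exp_mean.
Context d (T : measurableType d) (R : realType) (P : probability T R).
Implicit Types f g h : L0 P.

(** The square root of [exp(-|f|)]: products of two such functions are exponentials at midpoints.
    The absolute value keeps it in [[0, 1]] at every point, whatever the representative. *)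
Definition half_exp f (w : T) : R := expR (- (`|f w| / 2)).

Definition exp_mean f : R := \int[P]_w (half_exp f w ^+ 2).

Lemma half_exp_ge0 f w : 0 <= half_exp f w. Proof. exact: expR_ge0. Qed.

Lemma half_exp_le1 f w : half_exp f w <= 1.
Proof. by rewrite -expR0 ler_expR oppr_le0 divr_ge0. Qed.

Lemma measurable_half_exp f : measurable_fun setT (half_exp f).
Proof.
apply: measurableT_comp => //; apply: measurableT_comp => //.
by apply: measurable_funM => //; exact: measurableT_comp.
Qed.

Lemma integrable_half_expM f g :
  P.-integrable setT (EFin \o (fun w => half_exp f w * half_exp g w)).
Proof.
apply: (@le_integrable _ _ _ P setT measurableT _ (cst 1%E)) => //.
- apply/measurable_EFinP; apply: measurable_funM; exact: measurable_half_exp.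
- move=> w _ /=; rewrite normr1 lee_fin ger0_norm ?mulr_ge0 ?half_exp_ge0//.
  by rewrite mulr_ile1 ?half_exp_ge0 ?half_exp_le1.
- exact: finite_measure_integrable_cst.
Qed.

Lemma exp_mean_itv f : 0 <= exp_mean f <= 1.
Proof.
rewrite Rintegral_ge0/=; last by move=> w _; rewrite sqr_ge0.
rewrite (_ : 1 = \int[P]_w (cst 1 w)); last first.
  rewrite Rintegral_cst// mul1r; exact: (congr1 fine (esym (probability_setT P))).
apply: le_Rintegral => //.
- exact: integrable_half_expM.
- exact: finite_measure_integrable_cst.
- by move=> w _; rewrite exprn_ile1 ?half_exp_ge0 ?half_exp_le1.
Qed.

(** The exponential turns the sum in a midpoint into a product, once nonnegativity has removed the
    absolute values. The weight [1 - 2^-1] is the form in which convexity of a set supplies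
    midpoints. *)
Lemma exp_mean_midpoint f g : L0_nonneg P f -> L0_nonneg P g ->
  exp_mean (2^-1 *: f + (1 - 2^-1) *: g) = \int[P]_w (half_exp f w * half_exp g w).
Proof.
move=> f0 g0; congr fine; apply: ae_eq_integral => //.
- set m := 2^-1 *: f + (1 - 2^-1) *: g.
  by have /integrableP[] := integrable_half_expM m m.
- by have /integrableP[] := @integrable_half_expM f g.
near=> w => _; congr EFin.
have fw : 0 <= f w by near: w.
have gw : 0 <= g w by near: w.
rewrite /half_exp (near (L0_addE (2^-1 *: f) ((1 - 2^-1) *: g)) w)//.
rewrite (near (L0_scaleE 2^-1 f) w)// (near (L0_scaleE (1 - 2^-1) g) w)//.
rewrite expr2 -!expRD; congr expR.
have half1 : (1 - 2^-1 : R) = 2^-1 by lra.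
rewrite half1 !ger0_norm ?addr_ge0 ?mulr_ge0//.
by lra.
Unshelve. all: by end_near. Qed.

(* Parallelogram identity: the midpoint convexity gap of [exp_mean] is a squared
   L2 distance. *)
Lemma sqr_dist_half_exp f g : L0_nonneg P f -> L0_nonneg P g ->
  (\int[P]_w ((half_exp f w - half_exp g w) ^+ 2)%:E =
  (exp_mean f + exp_mean g - 2 * exp_mean (2^-1 *: f + (1 - 2^-1) *: g))%:E)%E.
Proof.
move=> f0 g0; rewrite exp_mean_midpoint//.
have iZ h k : P.-integrable setT (EFin \o (fun w => 2 * (half_exp h w * half_exp k w))).
  exact: (integrableZl measurableT 2 (integrable_half_expM h k)).
have iD : P.-integrable setT
    (EFin \o (fun w => half_exp f w ^+ 2 + half_exp g w ^+ 2)).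
  exact: (integrableD measurableT (integrable_half_expM f f)
    (integrable_half_expM g g)).
rewrite -RintegralZl//; last exact: integrable_half_expM.
rewrite -RintegralD//; [|exact: integrable_half_expM..].
rewrite -RintegralB//.
have -> : (fun w => ((half_exp f w - half_exp g w) ^+ 2)%:E) =
    EFin \o (fun w => half_exp f w ^+ 2 + half_exp g w ^+ 2 -
                      2 * (half_exp f w * half_exp g w)).
  by apply/funext => w /=; congr EFin; ring.
rewrite /Rintegral fineK//; apply: integrable_fin_num => //.
exact: (integrableB measurableT iD (iZ f g)).
Qed.

End exp_mean.

(** * Lower limits of events, and chains of near-minimizers *)

Lemma measure_liminf_le d (T : measurableType d) (R : realType)
    (mu : {measure set T -> \bar R}) (A : (set T)^nat) (c : \bar R) :
  (forall n, measurable (A n)) -> (forall n, (mu (A n) <= c)%E) ->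
  (mu (\bigcup_N \bigcap_(n in [set n | (N <= n)%N]) A n) <= c)%E.
Proof.
move=> mA Ac; set B := fun N => \bigcap_(n in [set n | (N <= n)%N]) A n.
have mB N : measurable (B N) by exact: bigcap_measurableType.
(* The tail intersections [B N] increase with [N], so continuity from below reduces the bound to
   each [B n], which lies in [A n]. *)
apply: (cvge_to_le (@nondecreasing_cvg_mu _ _ _ mu B mB _ _)).
- exact: bigcup_measurable.
- move=> n m nm; apply/subsetPset => w Bw k /= mk; apply: Bw.
  exact: leq_trans mk.
apply: nearW => n; apply: le_trans (Ac n); apply: le_measure; rewrite ?inE//.
by move=> w; apply => /=.
Qed.

(** Take for [s] the supremum, over nonempty finite index sets, of the infimum of [phi] on the
    corresponding intersection, and let [D n] collect index sets whose infima approach [s]. *)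
Lemma nearly_minimizing_chain (R : realType) (E I : Type) (F : I -> set E)
    (phi : E -> R) (eps : nat -> R) :
  [set: I] !=set0 -> (forall x, 0 <= phi x <= 1) -> (forall n, 0 < eps n) ->
  (forall A : set I, finite_set A -> A !=set0 -> \bigcap_(i in A) F i !=set0) ->
  exists (D : nat -> set I) (s : R),
    [/\ forall n, finite_set (D n),
        forall n m, (n <= m)%N -> D n `<=` D m,
        forall n x, (\bigcap_(i in D n) F i) x -> s - eps n <= phi x &
        forall (A : set I) e, finite_set A -> A !=set0 -> 0 < e ->
          exists2 x, (\bigcap_(i in A) F i) x & phi x < s + e].
Proof.
move=> [i0 _] phi01 eps0 fip.
pose K (A : set I) := \bigcap_(i in A) F i.
pose S : set R := [set inf (phi @` K A) | A in [set A | finite_set A /\ A !=set0]].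
have lb A : has_lbound (phi @` K A).
  by exists 0 => _ [x _ <-]; case/andP: (phi01 x).
have inf_le A x : K A x -> inf (phi @` K A) <= phi x.
  by move=> Kx; apply: (ge_inf (lb A)); exists x.
have has_infK A : finite_set A -> A !=set0 -> has_inf (phi @` K A).
  move=> fA A0; split; last exact: lb.
  by have [x Kx] := fip A fA A0; exists (phi x), x.
have S_ub : ubound S 1.
  move=> _ [A [fA A0] <-]; have [x Kx] := fip A fA A0.
  by apply: le_trans (inf_le _ _ Kx) _; case/andP: (phi01 x).
have S_sup : has_sup S.
  split; last by exists 1.
  by exists (inf (phi @` K [set i0])), [set i0] => //; split => //; exists i0.
have /choice[A AP] n : exists A : set I,
    [/\ finite_set A & sup S - eps n < inf (phi @` K A)].
  by have [_ [A [fA _] <-] sA] := sup_adherent (eps0 n) S_sup; exists A.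
(* Accumulating [A 0], ..., [A n] makes the chain increasing; more indices only shrink the
   intersection, so the lower bound obtained for [A n] survives. *)
exists (fun n => \bigcup_(k in `I_n.+1) A k), (sup S); split.
- by move=> n; apply: bigcup_finite => // k _; case: (AP k).
- move=> n m nm i [k /= kn Ai]; exists k => //=; exact: leq_trans nm.
- move=> n x Kx; apply: le_trans (inf_le (A n) x _).
    by apply: ltW; case: (AP n).
  by move=> i Ai; apply: Kx; exists n => /=.
move=> B e fB B0 e0.
have [_ [x Kx <-] xe] := inf_adherent e0 (has_infK _ fB B0).
exists x => //; apply: lt_le_trans xe _; rewrite lerD2r.
by apply: ub_le_sup; [exists 1|exists B].
Qed.

(** * Boundedness in probability gives convex compactness *)

Section bounded_convexly_compact.
Context d (T : measurableType d) (R : realType) (P : probability T R).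
Implicit Types (f g h : L0 P) (C : set (L0 P)).

(** Weighted by [4 ^+ n], the squared differences still have geometrically decaying integrals, hence
    are a.e. bounded in [n]; square roots then decay like [2 ^- n]. *)
Lemma ae_dist_half_exp (f_ h_ : nat -> L0 P) :
  (forall n, \int[P]_w ((half_exp (f_ n) w - half_exp (h_ n) w) ^+ 2)%:E
     <= (4 / 8 ^+ n)%:E)%E ->
  {ae P, forall w, exists K,
    forall n, `|half_exp (f_ n) w - half_exp (h_ n) w| <= K / 2 ^+ n}.
Proof.
move=> fh.
have md n : measurable_fun setT
    (fun w => (half_exp (f_ n) w - half_exp (h_ n) w) ^+ 2).
  by apply: measurable_funX; apply: measurable_funB; exact: measurable_half_exp.
have : {ae P, forall w, exists K, forall n,
    4 ^+ n * (half_exp (f_ n) w - half_exp (h_ n) w) ^+ 2 <= K}.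
  (* The constant is 8 because [4^n * 4 / 8^n = 8 / 2^(n+1)]. *)
  apply: (@ae_bounded_seq _ _ _ _ _ 8) => //.
  - by move=> n; apply: measurable_funM.
  - by move=> n w; rewrite mulr_ge0 ?sqr_ge0 ?exprn_ge0.
  move=> n; under eq_integral do rewrite EFinM.
  rewrite ge0_integralZl//; last 2 first.
  - exact/measurable_EFinP.
  - by move=> w _; rewrite lee_fin sqr_ge0.
  rewrite (_ : 8 / _ = 4 ^+ n * (4 / 8 ^+ n)); last first.
    rewrite natrX exprS (_ : 8 = 4 * 2 :> R); last by rewrite -natrM.
    rewrite exprMn; field.
    by rewrite !expf_neq0 ?pnatr_eq0.
  by rewrite EFinM lee_wpmul2l// lee_fin exprn_ge0.
(* [K + 1] replaces the square root of [K], since [K <= (K + 1)^2] for [K >= 0]. *)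
apply: filterS => w [K wK]; exists (K + 1) => n.
set x := half_exp (f_ n) w - _.
have K0 : 0 <= K by apply: le_trans (wK 0%N); rewrite mulr_ge0 ?sqr_ge0 ?exprn_ge0.
rewrite ler_pdivlMr ?exprn_gt0//.
rewrite -(@ler_pXn2r _ 2) ?nnegrE ?mulr_ge0 ?addr_ge0 ?exprn_ge0//.
rewrite exprMn real_normK ?num_real// -exprM mulnC exprM.
rewrite (_ : 2 ^+ 2 = 4); last by rewrite -natrX.
by rewrite mulrC (le_trans (wK n))//; nra.
Qed.

(** On nonnegative values [-2 ln] inverts [half_exp], and it is continuous at the positive limit. *)
Lemma half_exp_cvg (h_ : nat -> L0 P) w (y : R) : (forall n, 0 <= h_ n w) ->
  half_exp (h_ n) w @[n --> \oo] --> expR (- (y / 2)) ->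
  h_ n w @[n --> \oo] --> y.
Proof.
move=> h0 hy.
have -> : h_ ^~ w = fun n => - 2 * ln (half_exp (h_ n) w).
  by apply/funext => n; rewrite /half_exp expRK ger0_norm//; field.
rewrite (_ : y = - 2 * ln (expR (- (y / 2)))); last by rewrite expRK; field.
apply: cvgMr; apply: cvg_comp hy _; exact: (continuous_ln (expR_gt0 _)).
Qed.

(** Convergence to 0 means [|f_ n w|] tends to infinity, so for every [k] the point [w] lies in the
    lower limit of the events [M k <= |f_ n|], of probability at most [1 / (k + 1)]. *)
Lemma ae_half_exp_not_cvg0 C (f_ : nat -> L0 P) : bounded_in_probability C ->
  (forall n, C (f_ n)) ->
  {ae P, forall w, ~ (half_exp (f_ n) w @[n --> \oo] --> (0 : R))}.
Proof.
move=> /bounded_in_probabilityP bC Cf.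
have /choice[M MP] k : exists M : R, forall n,
    (P [set w | (M <= `|f_ n w|)%R] <= (k.+1%:R^-1)%:E)%E.
  have [|M MP] := bC (k.+1%:R^-1); first by rewrite invr_gt0.
  by exists M => n; exact: MP.
pose A k n := [set w | M k <= `|f_ n w|].
have mA k n : measurable (A k n).
  rewrite -[X in measurable X]setTI; apply: measurable_fun_le => //.
  exact: measurableT_comp.
pose B k := \bigcup_N \bigcap_(n in [set n | (N <= n)%N]) A k n.
have mB k : measurable (B k).
  by apply: bigcup_measurable => N _; exact: bigcap_measurableType.
exists (\bigcap_k B k); split.
- by apply: bigcap_measurableType.
- apply/eqP; rewrite eq_le measure_ge0 andbT; apply/lee_addgt0Pr => e e0.
  have /cvgrPdist_lt/(_ e e0)[k _ /(_ k (leqnn k))] := @cvg_harmonic R.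
  rewrite /= sub0r normrN gtr0_norm// add0e => ke.
  apply: (@le_trans _ _ (P (B k))).
    by apply: le_measure; rewrite ?inE//; [apply: bigcap_measurableType|move=> w; exact].
  apply: (@le_trans _ _ (k.+1%:R^-1)%:E); last by rewrite lee_fin ltW.
  by apply: (@measure_liminf_le _ _ _ P (A k)) => // n; exact: MP.
move=> w /contrapT/cvgrPdist_lt f0 k _.
have [N _ NP] := f0 (expR (- (M k / 2))) (expR_gt0 _).
exists N => // n /NP; rewrite /= sub0r normrN ger0_norm ?half_exp_ge0//.
by rewrite /A /half_exp/= ltr_expR ltrN2 ltr_pM2r// => /ltW.
Qed.

Lemma ae_cvg_of_half_exp_steps C (f_ : nat -> L0 P) :
  C `<=` L0_nonneg P -> bounded_in_probability C -> (forall n, C (f_ n)) ->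
  {ae P, forall w, exists K,
    forall n, `|half_exp (f_ n.+1) w - half_exp (f_ n) w| <= K / 2 ^+ n} ->
  exists f, {ae P, forall w, f_ n w @[n --> \oo] --> f w}.
Proof.
move=> C0 bC Cf steps.
(* The upper limit is measurable on the whole space, so it defines a class directly; [fine] sends
   infinite values to 0, which matters only on a null set. *)
pose F w := fine (limn_esup (fun n => (f_ n w)%:E)).
have mF : measurable_fun setT F.
  apply: measurableT_comp => //.
  by apply: measurable_fun_limn_esup => n; exact/measurable_EFinP.
pose G : {mfun T >-> R} := HB.pack F (isMeasurableFun.Build _ _ _ _ F mF).
exists (L0_class P G).
have f0 : {ae P, forall w, forall n, 0 <= f_ n w}.
  by apply/ae_foralln => n; exact: C0.
apply: filterS2 (filterI f0 steps) (filterI (ae_half_exp_not_cvg0 bC Cf)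
  (L0_classE P G)) => w [fw0 [K fK]] [lim0 ->].
have /cvg_ex[/= l fl] := cvgn_of_geometric_steps fK.
(* Boundedness in probability enters here: [l = 0] would correspond to an infinite limit of
   [f_ n w]. *)
have l0 : 0 < l.
  rewrite lt_neqAle; apply/andP; split.
    by apply/eqP => l0; apply: lim0; rewrite l0.
  by apply: (cvgr_to_ge fl); apply: nearW => n; exact: half_exp_ge0.
have fwl : f_ n w @[n --> \oo] --> (- 2 * ln l).
  apply: half_exp_cvg => //.
  by rewrite (_ : - (_ / 2) = ln l) ?lnK ?posrE//; field.
have /cvg_limn_einf_sup[_ El] : (f_ n w)%:E @[n --> \oo] --> (- 2 * ln l)%:E.
  by apply: cvg_EFin => //; exact: nearW.
by rewrite /= /F El.
Qed.

Lemma bounded_convexly_compact C : C `<=` L0_nonneg P -> convex_set C ->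
  bounded_in_probability C -> convexly_compact C.
Proof.
(* The limit f of near-minimizers f_n of exp_mean over the intersections along D
   lies in F i0. For any other i, near-minimizers h_n chosen moreover in F i are
   asymptotically as close to f_n, so they also converge to f. *)
move=> C0 cvC bC; split=> // J F [i0 _] FC fip.
have eps0 n : 0 < 8^-1 ^+ n :> R by rewrite exprn_gt0// invr_gt0.
have [D [s [fD D_mono s_le s_ge]]] := nearly_minimizing_chain
  (ex_intro _ i0 I) (exp_mean_itv (P := P)) eps0 fip.
pose K (A : set J) := \bigcap_(i in A) F i.
(* The midpoint stays in the convex set [K (D n)], so its mean is at least [s - 8^-n]; the gap is at
   most [2 (s + 8^-n) - 2 (s - 8^-n) = 4 / 8^n]. *)
have close n f g : L0_nonneg P f -> L0_nonneg P g -> K (D n) f -> K (D n) g ->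
    exp_mean f < s + 8^-1 ^+ n -> exp_mean g < s + 8^-1 ^+ n ->
    (\int[P]_w ((half_exp f w - half_exp g w) ^+ 2)%:E <= (4 / 8 ^+ n)%:E)%E.
  move=> f0 g0 Kf Kg fs gs; rewrite sqr_dist_half_exp// lee_fin -exprVn.
  have := s_le n (2^-1 *: f + (1 - 2^-1) *: g).
  suff Kfg : K (D n) (2^-1 *: f + (1 - 2^-1) *: g) by move=> /(_ Kfg); lra.
  move=> i Di; have [_ _ cvF] := FC i.
  have half_le1 : 2^-1 <= 1 :> R by rewrite invf_le1 ?ler1n.
  have half_ge0 : 0 <= 2^-1 :> R by rewrite invr_ge0.
  have := cvF f g (Itv01 half_ge0 half_le1).
  by rewrite !inE; apply; [exact: Kf|exact: Kg].
(* Adjoining [i] to [D n] keeps the index set finite and nonempty, so values below [s + 8^-n] are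
   still reached. *)
have minimizer i n : exists f,
    [/\ K (D n) f, F i f & exp_mean f < s + 8^-1 ^+ n].
  have [|||f Kf fs] := s_ge (D n `|` [set i]) (8^-1 ^+ n) => //.
  - by rewrite finite_setU; split.
  - by exists i; right.
  by exists f; split=> //; [move=> j Dj; apply: Kf; left|apply: Kf; right].
have /choice[f_ f_P] := minimizer i0.
have F0 i f : F i f -> L0_nonneg P f.
  by move=> Fif; apply: C0; have [FiC _ _] := FC i; exact: FiC.
have K_mono n m f : (n <= m)%N -> K (D m) f -> K (D n) f.
  by move=> nm Kf i Di; apply: Kf; exact: D_mono Di.
have [f f_f] : exists f, {ae P, forall w, f_ n w @[n --> \oo] --> f w}.
  apply: (@ae_cvg_of_half_exp_steps C) => //.
    by move=> n; have [FiC _ _] := FC i0; apply: FiC; case: (f_P n).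
  apply: ae_dist_half_exp => n.
  have [Kn Fn sn] := f_P n; have [Kn1 Fn1 sn1] := f_P n.+1.
  apply: close => //; [exact: F0 Fn1|exact: F0 Fn|exact: K_mono Kn1|].
  by apply: lt_le_trans sn1 _; rewrite lerD2l exprS ger_pMl// invf_le1 ?ler1n.
exists f => i _; have /choice[h_ h_P] := minimizer i.
have [_ clF _] := FC i.
apply: (closed_cvg _ clF (u_ := h_) (F := \oo)).
  by apply: nearW => n; case: (h_P n).
apply: ae_cvg_L0.
have fh : {ae P, forall w, exists K,
    forall n, `|half_exp (f_ n) w - half_exp (h_ n) w| <= K / 2 ^+ n}.
  apply: ae_dist_half_exp => n.
  have [Kn Fn sn] := f_P n; have [Kn1 Fn1 sn1] := h_P n.
  by apply: close => //; [exact: F0 Fn|exact: F0 Fn1].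
have f0 : {ae P, forall w, forall n, 0 <= f_ n w}.
  by apply/ae_foralln => n; case: (f_P n) => _ /F0.
have h0 : {ae P, forall w, forall n, 0 <= h_ n w}.
  by apply/ae_foralln => n; case: (h_P n) => _ /F0.
apply: filterS2 (filterI f_f fh) (filterI f0 h0) => w [fw [M wM]] [fw0 hw0].
apply: half_exp_cvg => //.
(* Write [half_exp (h_ n)] as [half_exp (f_ n)] minus a difference that is squeezed to 0
   geometrically. *)
have -> : (fun n => half_exp (h_ n) w) =
    (fun n => half_exp (f_ n) w - (half_exp (f_ n) w - half_exp (h_ n) w)).
  by apply/funext => n; rewrite opprB addrC subrK.
rewrite -[X in _ --> X]subr0; apply: cvgB.
  have -> : (fun n => half_exp (f_ n) w) = (fun n => expR (- (f_ n w / 2))).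
    by apply/funext => n; rewrite /half_exp ger0_norm.
  apply: (cvg_comp (fun n => - (f_ n w / 2)) expR); last exact: continuous_expR.
  by apply: cvgN; exact: cvgMl.
apply/norm_cvg0P; apply: (@squeeze_cvgr _ _ _ _ (cst 0) (geometric M 2^-1)).
- by apply: nearW => n /=; rewrite normr_ge0 exprVn wM.
- exact: cvg_cst.
- by apply: cvg_geometric; rewrite ger0_norm ?invf_lt1 ?ltr1n.
Qed.

End bounded_convexly_compact.

Theorem theorem3p1 (d : measure_display) (T : measurableType d) (R : realType)
    (P : probability T R) (hP : measure_is_complete P) (C : set (L0 P))
    (C_ge0 : C `<=` L0_nonneg P) (C_closed : closed C)
    (C_convex : convex_set C) :
  convexly_compact C <-> bounded_in_probability C.
Proof.
split; first exact: convexly_compact_bounded.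
exact: bounded_convexly_compact.
Qed.
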